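(* Let $s$ be the van der Waals specific entropy on its domain $D_s$, and suppose that $\frac{\partial^2 s}{\partial e^2}<0$ on $D_s$. For $(\tau,e)\in D_s$ consider the maximization problem $$\sigma(\tau,e)=\sup \sum_{i=1}^{I}\varphi_i\, s(\tau_i,e_i)$$ over finite families of mass fractions $\varphi_i\in[0,1]$ and states $(\tau_i,e_i)\in D_s$ subject to $$\sum_{i=1}^I\varphi_i=1,\qquad \sum_{i=1}^I\varphi_i\tau_i=\tau,\qquad \sum_{i=1}^I\varphi_i e_i=e .$$ Let $I(\tau,e)$ denote the number of phases coexisting at thermodynamic equilibrium for the state $(\tau,e)$. Then $$I(\tau,e)<3\qquad\text{for all }(\tau,e)\in D_s .$$
   Context: Notation: $\mathbb{R}^+=[0,+\infty)$. Fixed constants: $R>0$, $C_v>0$, $a\ge 0$, $b\ge 0$, $s_0\in\mathbb{R}$. The van der Waals specific entropy is $$s(\tau,e)=C_v\ln\Big(\frac{a}{\tau}+e\Big)+R\ln(\tau-b)+s_0,$$ defined on $D_s=\{(\tau,e)\in(\mathbb{R}^+)^2:\ \tau>b,\ \frac a\tau+e>0\}$. Here $\tau$ is the specific volume and $e$ the specific internal energy. A multicomponent system in state $(\tau,e)$ is divided into finitely many subsystems, all described by the same entropy $s$; subsystem $i$ has mass fraction $\varphi_i$, specific volume $\tau_i$ and specific energy $e_i$. Thermodynamic equilibrium means that the supremum in the maximization problem is attained by the decomposition considered. The number of phases coexisting at equilibrium is the number of pairwise distinct states $(\tau_i,e_i)$ with $\varphi_i>0$ in a maximizing decomposition; the assertion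 $I(\tau,e)<3$ means that no maximizing decomposition involves three or more such states.
   Formalization: The states with b = 0, R = C_v and e = 0 are excluded: there s(τ,0) = C_v ln a + s_0 is constant in τ, so every decomposition of (τ,0) is maximizing and any number of phases can coexist, so the claim as stated fails. *)

(* Defs.v *)
From mathcomp Require Import all_boot all_order all_algebra.
From mathcomp Require Import all_classical all_reals all_analysis.

Set Implicit Arguments.
Unset Strict Implicit.
Unset Printing Implicit Defensive.

Import Order.TTheory GRing.Theory Num.Theory.

Local Open Scope classical_set_scope.
Local Open Scope ring_scope.

(* The scalar field is [R : realType]; the specific gas constant is [Rg]. *)

(* A state is a pair (specific volume, specific energy). *)
Definition vdw_domain (R : realType) (a b : R) (x : R * R) : Prop :=
  [/\ 0 <= x.1, 0 <= x.2, b < x.1 & 0 < a / x.1 + x.2].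

Definition vdw_entropy (R : realType) (Cv Rg a b s0 tau e : R) : R :=
  Cv * ln (a / tau + e) + Rg * ln (tau - b) + s0.

(* On the boundary e = 0 of the domain (reached only when 0 < a), the entropy
   formula is smooth across e = 0, so the two-sided derivative is meant. *)
Definition vdw_d2s_de2 (R : realType) (Cv Rg a b s0 tau e : R) : R :=
  ((vdw_entropy Cv Rg a b s0 tau)^`(2))%classic e.

(* The finite family of subsystems is indexed by 'I_n, with n arbitrary. *)
Definition decomposition (R : realType) (a b tau e : R)
    (n : nat) (phi : 'I_n -> R) (x : 'I_n -> R * R) : Prop :=
  [/\ forall i, 0 <= phi i <= 1,
      forall i, vdw_domain a b (x i),
      \sum_(i < n) phi i = 1,
      \sum_(i < n) phi i * (x i).1 = tau
    & \sum_(i < n) phi i * (x i).2 = e].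

Definition mixture_entropy (R : realType) (Cv Rg a b s0 : R)
    (n : nat) (phi : 'I_n -> R) (x : 'I_n -> R * R) : R :=
  \sum_(i < n) phi i * vdw_entropy Cv Rg a b s0 (x i).1 (x i).2.

(* The supremum is taken in the extended reals, since it can be infinite, for
   instance when b = 0 < a and Rg < Cv; it is then not attained. *)
Definition sigma (R : realType) (Cv Rg a b s0 tau e : R) : \bar R :=
  ereal_sup [set y : \bar R |
    exists (n : nat) (phi : 'I_n -> R) (x : 'I_n -> R * R),
      decomposition a b tau e phi x /\
      y = (mixture_entropy Cv Rg a b s0 phi x)%:E].

Definition equilibrium (R : realType) (Cv Rg a b s0 tau e : R)
    (n : nat) (phi : 'I_n -> R) (x : 'I_n -> R * R) : Prop :=
  decomposition a b tau e phi x /\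
  (mixture_entropy Cv Rg a b s0 phi x)%:E = sigma Cv Rg a b s0 tau e.

(* Subsystems in equal states count as one phase; those of zero mass do not
   count. *)
Definition nb_phases (R : realType)
    (n : nat) (phi : 'I_n -> R) (x : 'I_n -> R * R) : nat :=
  size (undup [seq x i | i <- enum 'I_n & 0 < phi i]).

(* Main.v *)
Require Import Defs.
From mathcomp Require Import all_boot all_order all_algebra.
From mathcomp Require Import all_classical all_reals all_analysis.
From mathcomp Require Import ring lra.

(* At equilibrium the tangent plane of s at a phase with positive energy lies
   above s on the whole domain and touches it at every phase. Let theta be the
   common value of a / tau + e prescribed by the slope of this plane in e, and
   c = a / theta. Strict concavity in e leaves at most one energy for each
   volume: theta - a / tau if tau >= c (warm phases), 0 if tau < c (cold
   phases). The phases thus maximize one of two functions of tau,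
     Rg ln (tau - b) + Cv c / tau - beta tau        on the warm range,
     Rg ln (tau - b) - Cv ln tau - beta tau         on ]b, +oo[ (cold),
   which agree at c to first order, up to a constant. The numerators of their
   derivatives are a cubic and a quadratic. Three warm phases give two critical
   maxima and, by Rolle, two further critical points: four roots of the cubic.
   Two cold phases give three roots of the quadratic. With one cold and two warm
   phases, beta > 0 forces the cold function, hence the warm one, to decrease at
   c, so that the cubic has another root between c and the first warm phase,
   four in all. If e = 0, all phases have energy 0 and
   already two of them are excluded in the same way as two cold phases. *)

Set Implicit Arguments.
Unset Strict Implicit.
Unset Printing Implicit Defensive.

Import Order.TTheory GRing.Theory Num.Theory numFieldNormedType.Exports.

Local Open Scope ring_scope.

(** * Calculus of the functions of the volume alone *)

Section profiles.
Local Open Scope classical_set_scope.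
Local Open Scope ring_scope.
Context {R : realType}.
Implicit Types (A B a b c t u v beta theta : R).

(** Perturbed decompositions are available only for small h > 0, since masses and energies must stay
    nonnegative; hence a one-sided first-order condition. *)
Lemma is_derive_le0_right (f : R -> R) (x d : R) :
  is_derive x 1 f d -> (\forall h \near 0^'+, f (x + h) <= f x) -> d <= 0.
Proof.
move=> [fx <-] le_f.
rewrite ['D_1 f x]cvg_at_rightE; last exact: fx.
apply: limr_le.
  rewrite -(cvg_at_rightE (fun h : R => h^-1 *: ((f \o shift x) _ - f x))) //.
  apply: cvg_trans fx; apply: cvg_app.
  move=> A0 [e egt0 Ae]; exists e => // z xe_z zgt0.
  by apply: Ae => //; exact/lt0r_neq0.
near=> h.
rewrite /= pmulr_rle0 ?invr_gt0; last by near: h; exact: nbhs_right_gt.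
by rewrite subr_le0 [_%:A]mulr1 (addrC h); near: h.
Unshelve. all: by end_near. Qed.

Lemma near_right_affine_gt0 A B : 0 < A -> \forall t \near 0^'+, 0 < A + t * B.
Proof.
move=> A0; have B0 : 0 < `|B| + 1 by rewrite ltr_wpDl.
near=> t.
have t0 : 0 < t by near: t; exact: nbhs_right_gt.
have : t < A / (`|B| + 1) by near: t; apply: nbhs_right_lt; rewrite divr_gt0.
rewrite ltr_pdivlMr// => tA.
have := ler_norm (- B); rewrite normrN => B'.
nra.
Unshelve. all: by end_near. Qed.

Lemma is_derive_affine (u d t : R) : is_derive t 1 (fun t : R => u + t * d) d.
Proof. by apply: is_derive_eq; rewrite /GRing.scale /=; ring. Qed.

Lemma is_derive_ln_affine u (d : R) : 0 < u ->
  is_derive (0 : R) 1 (fun t => ln (u + t * d)) (d / u).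
Proof.
move=> u0; have l0 : 0 < u + 0 * d by rewrite mul0r addr0.
have := @is_derive1_comp _ (@ln R) (fun t => u + t * d) _ _ _
  (is_derive1_ln l0) (is_derive_affine u d 0).
by rewrite mul0r addr0 mulrC.
Qed.

(* B = 0 on the warm range; A = 0 for cold phases. *)
Definition profile (Rg b A B beta t : R) : R :=
  Rg * ln (t - b) + A / t - B * ln t - beta * t.

Definition dprofile (Rg b A B beta t : R) : R :=
  Rg / (t - b) - A / t ^+ 2 - B / t - beta.

(** Numerator of [dprofile] over [t ^+ 2 * (t - b)], coefficients from degree 0 up. For A = 0 it is
    t times the cold quadratic. *)
Definition profile_poly (Rg b A B beta : R) : {poly R} :=
  Poly [:: A * b; B * b - A; beta * b + Rg - B; - beta].

Lemma profile_polyE Rg b A B beta t : 0 <= b -> b < t ->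
  (profile_poly Rg b A B beta).[t] =
  dprofile Rg b A B beta t * (t ^+ 2 * (t - b)).
Proof.
move=> b0 bt; have t0 : t != 0 by rewrite gt_eqF// (le_lt_trans b0).
have tb : t - b != 0 by rewrite subr_eq0 gt_eqF.
rewrite /profile_poly horner_Poly /= /dprofile; field.
by rewrite t0 tb.
Qed.

Lemma is_derive_profile Rg b A B beta t : 0 <= b -> b < t ->
  is_derive t 1 (profile Rg b A B beta) (dprofile Rg b A B beta t).
Proof.
move=> b0 bt; have t0 : 0 < t by rewrite (le_lt_trans b0).
have tb : 0 < t + - b by rewrite subr_gt0.
have tn0 := lt0r_neq0 t0.
have dt : is_derive t 1 (fun t : R => t^-1) (- t ^- 2 *: 1).
  by apply: is_deriveV.
have ds : is_derive t 1 (fun t : R => t - b) 1.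
  by apply: is_derive_eq; rewrite /GRing.scale /=; ring.
have dl := @is_derive1_comp _ (@ln R) (fun t => t - b) _ _ _
  (is_derive1_ln tb) ds.
have dl' := is_derive1_ln t0.
rewrite /profile; apply: is_derive_eq.
rewrite /dprofile /GRing.scale /=.
by field; rewrite tn0 (lt0r_neq0 tb).
Qed.

Lemma profile_crit Rg b A B beta u v t : 0 <= b -> b <= u -> u < t -> t < v ->
  (forall w, u < w -> w < v ->
    profile Rg b A B beta w <= profile Rg b A B beta t) ->
  root (profile_poly Rg b A B beta) t.
Proof.
move=> b0 bu ut tv tmax; have bt := le_lt_trans bu ut.
have [_ dF] : is_derive t 1 (profile Rg b A B beta) 0.
  apply: (@derive1_at_max _ _ u v t (ltW (lt_trans ut tv))).
  - move=> w /[!in_itv]/= /andP[uw _].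
    by case: (is_derive_profile Rg A B beta b0 (le_lt_trans bu uw)).
  - by rewrite in_itv/= ut.
  - by move=> w /[!in_itv]/= /andP[uw wv]; exact: tmax.
have [_ dF'] := is_derive_profile Rg A B beta b0 bt.
by rewrite /root profile_polyE// -dF' dF mul0r.
Qed.

Lemma profile_within_continuous Rg b A B beta u v : 0 <= b -> b < u ->
  {within `[u, v], continuous (profile Rg b A B beta)}.
Proof.
move=> b0 bu; apply: derivable_within_continuous => w /[!in_itv]/= /andP[uw _].
by case: (is_derive_profile Rg A B beta b0 (lt_le_trans bu uw)).
Qed.

Lemma profile_rolle Rg b A B beta u v : 0 <= b -> b < u -> u < v ->
  profile Rg b A B beta u = profile Rg b A B beta v ->
  exists m, [/\ u < m, m < v & root (profile_poly Rg b A B beta) m].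
Proof.
move=> b0 bu uv Fuv.
have [||m /[!in_itv]/= /andP[um mv] [_ dF]] := Rolle uv _ _ Fuv.
- move=> w /[!in_itv]/= /andP[uw _].
  by case: (is_derive_profile Rg A B beta b0 (lt_trans bu uw)).
- exact: profile_within_continuous.
exists m; split=> //; have bm := lt_trans bu um.
have [_ dF'] := is_derive_profile Rg A B beta b0 bm.
by rewrite /root profile_polyE// -dF' dF mul0r.
Qed.

Lemma profile_mvt Rg b A B beta u v : 0 <= b -> b < u -> u < v ->
  profile Rg b A B beta u < profile Rg b A B beta v ->
  exists m, [/\ u < m, m < v & 0 < (profile_poly Rg b A B beta).[m]].
Proof.
move=> b0 bu uv Fuv.
have [||m /[!in_itv]/= /andP[um mv] dF] :=
  @MVT _ (profile Rg b A B beta) (dprofile Rg b A B beta) _ _ uv.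
- move=> w /[!in_itv]/= /andP[uw _].
  exact: (is_derive_profile Rg A B beta b0 (lt_trans bu uw)).
- exact: profile_within_continuous.
exists m; split=> //; have bm := lt_trans bu um.
rewrite profile_polyE// mulr_gt0//; last first.
  by rewrite mulr_gt0 ?subr_gt0// exprn_gt0// (le_lt_trans b0).
have : 0 < profile Rg b A B beta v - profile Rg b A B beta u.
  by rewrite subr_gt0.
by rewrite dF pmulr_lgt0// subr_gt0.
Qed.

(** * Counting critical points of the profiles *)

Lemma profile_poly_roots4 Rg b A B beta t1 t2 t3 t4 :
  t1 < t2 -> t2 < t3 -> t3 < t4 ->
  all (root (profile_poly Rg b A B beta)) [:: t1; t2; t3; t4] ->
  [/\ A * b = 0, B * b = A, beta = 0 & Rg = B].
Proof.
move=> t12 t23 t34 rts.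
have p0 : profile_poly Rg b A B beta = 0.
  apply: (roots_geq_poly_eq0 rts); last exact: size_Poly.
  apply: (@sorted_uniq _ <%R lt_trans ltxx) => /=.
  by rewrite t12 t23 t34.
have c i : [:: A * b; B * b - A; beta * b + Rg - B; - beta]`_i = 0.
  by rewrite -coef_Poly -/(profile_poly _ _ _ _ _) p0 coef0.
move: (c 0%N) (c 1%N) (c 2%N) (c 3%N) => /= c0 c1 c2 /eqP.
rewrite oppr_eq0 => /eqP beta0; split=> //; first by apply/subr0_eq.
by apply/subr0_eq; rewrite -c2 beta0 mul0r add0r.
Qed.

(** The maximizer t1 may be the endpoint c, where the derivative need not vanish, so only t2 and t3
    count as critical; Rolle supplies the other two roots. *)
Lemma profile_three_max Rg b A B beta c K t1 t2 t3 :
  0 <= b -> b < t1 -> c <= t1 -> t1 < t2 -> t2 < t3 ->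
  (forall t, b < t -> c <= t -> profile Rg b A B beta t <= K) ->
  profile Rg b A B beta t1 = K -> profile Rg b A B beta t2 = K ->
  profile Rg b A B beta t3 = K ->
  [/\ A * b = 0, B * b = A, beta = 0 & Rg = B].
Proof.
move=> b0 b1 c1 t12 t23 leK F1 F2 F3.
have b2 := lt_trans b1 t12.
have [m [m1 m2 rm]] := profile_rolle b0 b1 t12 (etrans F1 (esym F2)).
have [p [p1 p2 rp]] := profile_rolle b0 b2 t23 (etrans F2 (esym F3)).
have crit t : t1 < t -> profile Rg b A B beta t = K ->
    root (profile_poly Rg b A B beta) t.
  move=> t1t Ft; apply: (profile_crit b0 (ltW b1) t1t (v := t + 1)).
    by rewrite ltrDl.
  move=> w t1w _; rewrite Ft leK ?(lt_trans b1)//.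
  exact/ltW/(le_lt_trans c1).
apply: (profile_poly_roots4 m2 p1 p2).
by rewrite /= rm rp !crit// (lt_trans t12).
Qed.

(** Both maximizers are interior to ]b, +oo[, hence critical, with a Rolle point between them. The
    resulting equations describe a constant profile, so they cannot be refuted here. *)
Lemma profile_two_max Rg b B beta K t1 t2 :
  0 <= b -> b < t1 -> t1 < t2 ->
  (forall t, b < t -> profile Rg b 0 B beta t <= K) ->
  profile Rg b 0 B beta t1 = K -> profile Rg b 0 B beta t2 = K ->
  [/\ B * b = 0, beta = 0 & Rg = B].
Proof.
move=> b0 b1 t12 leK F1 F2.
have [m [m1 m2 rm]] := profile_rolle b0 b1 t12 (etrans F1 (esym F2)).
have crit t : b < t -> profile Rg b 0 B beta t = K ->
    root (profile_poly Rg b 0 B beta) t.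
  move=> bt Ft; apply: (profile_crit b0 (lexx b) bt (v := t + 1)).
    by rewrite ltrDl.
  by move=> w bw _; rewrite Ft leK.
(* When A = 0 the cubic numerator vanishes at 0, which is a fourth root. *)
have r0 : root (profile_poly Rg b 0 B beta) 0.
  by rewrite /root horner_Poly /= mulr0 mul0r addr0.
have [] // := profile_poly_roots4 (le_lt_trans b0 b1) m1 m2
  (Rg := Rg) (b := b) (A := 0) (B := B) (beta := beta).
by rewrite /= r0 rm !crit// (lt_trans b1).
Qed.

Lemma profile_left_max_decreasing Rg b B beta t c : 0 < Rg -> 0 < beta ->
  0 <= b -> b < t -> t < c -> root (profile_poly Rg b 0 B beta) t ->
  (profile_poly Rg b 0 B beta).[c] < 0.
Proof.
move=> Rg0 beta0 b0 bt tc /rootP.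
rewrite !horner_Poly /= => rt.
(* The cubic divided by its factor t; its value at b is Rg * b. *)
set q := fun t => - beta * t ^+ 2 + (beta * b + Rg - B) * t + B * b.
have qt : q t = 0.
  apply: (mulfI (lt0r_neq0 (le_lt_trans b0 bt))).
  by rewrite mulr0 -rt /q; ring.
have qb : 0 <= q b by rewrite /q; have := mulr_ge0 (ltW Rg0) b0; nra.
(* Concavity of q, with q b >= 0 and q t = 0. *)
have qc : (t - b) * q c =
    (c - b) * q t - (c - t) * q b - beta * (c - b) * (c - t) * (t - b).
  by rewrite /q; ring.
have bt' : 0 < t - b by lra.
have tc' : 0 < c - t by lra.
have bc' : 0 < c - b by lra.
have : (t - b) * q c < 0.
  rewrite qc qt.
  have := mulr_ge0 (ltW tc') qb.
  have := mulr_gt0 (mulr_gt0 (mulr_gt0 beta0 bc') tc') bt'; lra.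
rewrite pmulr_rlt0// => qc0.
have c0 : 0 < c by lra.
have : c * q c < 0 by rewrite pmulr_rlt0.
rewrite /q; lra.
Qed.

Lemma profile_bounded_slope Rg b A beta c K : 0 < Rg -> 0 <= b -> 0 <= A ->
  (forall t, b < t -> c <= t -> profile Rg b A 0 beta t <= K) -> 0 < beta.
Proof.
move=> Rg0 b0 A0 leK; rewrite ltNge; apply/negP => beta0.
(* If beta <= 0 the logarithm is unbounded: M is large enough for Rg * M > |K| and b + exp M >=
   c. *)
set M := `|c| + `|K| / Rg + 1.
have M0 : 0 <= `|K| / Rg by rewrite divr_ge0// ltW.
have expM := expR_ge1Dx M.
have c0 := ler_norm c; have cn := normr_ge0 c.
have e0 := expR_gt0 M.
have := leK (b + expR M).
rewrite ltrDl e0 => /(_ isT).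
have ct : c <= b + expR M by rewrite /M in expM *; lra.
move=> /(_ ct); rewrite /profile (addrC b) addrK expRK mul0r subr0.
have At : 0 <= A / (expR M + b) by rewrite divr_ge0//; lra.
have bt : beta * (expR M + b) <= 0 by rewrite mulr_le0_ge0//; lra.
have : `|K| < Rg * M.
  rewrite /M !mulrDr mulr1 (mulrC _ (_ / _)) divfK ?gt_eqF//.
  have := mulr_ge0 (ltW Rg0) cn; lra.
have := ler_norm K; lra.
Qed.

(** The offset [Cv * ln c + Cv] is the gap between the warm and the cold profile at c. *)
Lemma profile_mixed_max Rg Cv b beta c K t1 t2 t3 :
  0 < Rg -> 0 < Cv -> 0 <= b -> b < t1 -> t1 < c -> c <= t2 -> t2 < t3 ->
  (forall t, b < t -> profile Rg b 0 Cv beta t <= K) ->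
  (forall t, b < t -> c <= t ->
    profile Rg b (Cv * c) 0 beta t <= K + Cv * ln c + Cv) ->
  profile Rg b 0 Cv beta t1 = K ->
  profile Rg b (Cv * c) 0 beta t2 = K + Cv * ln c + Cv ->
  profile Rg b (Cv * c) 0 beta t3 = K + Cv * ln c + Cv -> False.
Proof.
move=> Rg0 Cv0 b0 b1 t1c ct2 t23 leQ leP Q1 P2 P3.
have bc := lt_trans b1 t1c; have c0 := le_lt_trans b0 bc.
have beta0 : 0 < beta.
  by apply: (profile_bounded_slope Rg0 b0 _ leP); rewrite mulr_ge0// ltW.
have PQc : profile Rg b (Cv * c) 0 beta c =
    profile Rg b 0 Cv beta c + Cv * ln c + Cv.
  by rewrite /profile mulfK ?gt_eqF//; ring.
(* Equality would make c a second cold maximizer, which forces beta = 0. *)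
have Pc : profile Rg b (Cv * c) 0 beta c < K + Cv * ln c + Cv.
  rewrite lt_neqAle leP// andbT; apply/eqP; rewrite PQc => Qc'.
  have Qc : profile Rg b 0 Cv beta c = K by lra.
  have [_ beta_0 _] := profile_two_max b0 b1 t1c leQ Q1 Qc.
  by rewrite beta_0 ltxx in beta0.
have {}ct2 : c < t2.
  rewrite lt_neqAle ct2 andbT; apply/eqP => ct; move: P2 Pc.
  by rewrite -ct => ->; rewrite ltxx.
have b2 := lt_trans bc ct2.
have root1 : root (profile_poly Rg b 0 Cv beta) t1.
  apply: (profile_crit b0 (lexx b) b1 (v := t1 + 1)); first by rewrite ltrDl.
  by move=> w bw _; rewrite Q1 leQ.
(* Both profiles have the same derivative at c, so the sign of the cold cubic carries over. *)
have polyc : (profile_poly Rg b (Cv * c) 0 beta).[c] < 0.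
  have := profile_left_max_decreasing Rg0 beta0 b0 b1 t1c root1.
  by congr (_ < 0); rewrite !profile_polyE// /dprofile; field;
    rewrite subr_eq0 !gt_eqF.
(* The warm profile decreases at c but must climb to its maximum at t2: the cubic changes sign
   before t2, which gives the fourth root. *)
rewrite -P2 in Pc; have [h [ch h2 polyh]] := profile_mvt b0 bc ct2 Pc.
have [|z /andP[_ zh] rz] :=
  @poly_ivt _ (profile_poly Rg b (Cv * c) 0 beta) _ _ (ltW ch).
  by rewrite !ltW.
have [m [m2 m3 rm]] := profile_rolle b0 b2 t23 (etrans P2 (esym P3)).
have crit t : c < t -> profile Rg b (Cv * c) 0 beta t = K + Cv * ln c + Cv ->
    root (profile_poly Rg b (Cv * c) 0 beta) t.
  move=> ct Pt; apply: (profile_crit b0 (ltW bc) ct (v := t + 1)).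
    by rewrite ltrDl.
  by move=> w cw _; rewrite Pt leP ?(lt_trans bc)// ltW.
have [] : [/\ Cv * c * b = 0, 0 * b = Cv * c, beta = 0 & Rg = 0].
  apply: (profile_poly_roots4 (le_lt_trans zh h2) m2 m3).
  by rewrite /= rz rm !crit// (lt_trans ct2).
by move=> _ _ _ Rg_0; rewrite Rg_0 ltxx in Rg0.
Qed.
End profiles.

(** * Perturbing an equilibrium decomposition *)

Section mixtures.
Local Open Scope classical_set_scope.
Local Open Scope ring_scope.
Context {R : realType} (Cv Rg a b s0 : R).
Context (Rg_gt0 : 0 < Rg) (Cv_gt0 : 0 < Cv) (a_ge0 : 0 <= a) (b_ge0 : 0 <= b).
Implicit Types (tau e t : R).
Local Notation s x := (vdw_entropy Cv Rg a b s0 x.1 x.2).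
Local Notation dom := (vdw_domain a b).

Lemma vdw_domainP (x : R * R) :
  dom x <-> [/\ b < x.1, 0 <= x.2 & 0 < a \/ 0 < x.2].
Proof.
split=> [[x1 x2 bx ax]|[bx x2 ax]].
  split=> //; have [a0|] := ltP 0 a; first by left.
  move=> a0; right; have a_0 : a = 0 by apply/le_anti; rewrite a0.
  by rewrite a_0 mul0r add0r in ax.
have x1 := le_lt_trans b_ge0 bx.
split=> //; first exact: ltW.
case: ax => [a0|x20]; first by rewrite ltr_wpDr// divr_gt0.
by rewrite ltr_wpDl// divr_ge0// ltW.
Qed.

Lemma equilibrium_ge tau e n (phi : 'I_n -> R) w m (psi : 'I_m -> R) y :
  equilibrium Cv Rg a b s0 tau e phi w -> decomposition a b tau e psi y ->
  mixture_entropy Cv Rg a b s0 psi y <= mixture_entropy Cv Rg a b s0 phi w.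
Proof.
move=> [_ eq_sigma] dec; rewrite -lee_fin eq_sigma.
by apply: ereal_sup_ubound; exists m, psi, y.
Qed.

Lemma fraction_le1 n (phi : 'I_n -> R) i :
  (forall i, 0 <= phi i) -> \sum_i phi i = 1 -> phi i <= 1.
Proof.
move=> phi0 <-; rewrite (bigD1 i)//= lerDl.
by apply: sumr_ge0 => j _; exact: phi0.
Qed.

(** Total mass, volume, energy and entropy are all weighted sums of some F, so one identity serves
    all four; the last term vanishes for the conserved ones. *)
Lemma exchange_sum n (phi : 'I_n -> R) (w : 'I_n -> R * R) i j t (z : R * R)
    (F : R * R -> R) : i != j -> 1 + t != 0 ->
  \sum_k (if k == i then phi i / (1 + t)
          else if k == j then phi j + phi i * t / (1 + t) else phi k) *
    F (if k == i then z else w k) =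
  \sum_k phi k * F (w k) +
    phi i / (1 + t) * (F z + t * F (w j) - (1 + t) * F (w i)).
Proof.
move=> ij t1; have ji : j != i by rewrite eq_sym.
rewrite (bigD1 i)//= (bigD1 j)//= [in RHS](bigD1 i)//= [in RHS](bigD1 j)//=.
rewrite !eqxx (negPf ji).
set S := \sum_(k < n | _) _; set S' := \sum_(k < n | _) _.
have -> : S = S'.
  by apply: eq_bigr => k /andP[ki kj]; rewrite (negPf ki) (negPf kj).
by field.
Qed.

(* With phi_i w_i = phi_i / (1 + t) (z + t w_j), mass of subsystem i is
   transferred to j when t > 0 and from j when t < 0. *)
Lemma equilibrium_exchange tau e n (phi : 'I_n -> R) (w : 'I_n -> R * R)
    i j t z :
  equilibrium Cv Rg a b s0 tau e phi w -> i != j -> 0 < phi i ->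
  0 < 1 + t -> 0 <= phi j * (1 + t) + phi i * t ->
  z.1 = (w i).1 + t * ((w i).1 - (w j).1) ->
  z.2 = (w i).2 + t * ((w i).2 - (w j).2) -> dom z ->
  s z + t * s (w j) <= (1 + t) * s (w i).
Proof.
move=> eqm ij phii t0 phij z1 z2 domz.
have [[phi01 domw sum1 sumtau sume] _] := eqm.
have tn0 := lt0r_neq0 t0.
pose psi k := if k == i then phi i / (1 + t)
  else if k == j then phi j + phi i * t / (1 + t) else phi k.
pose y k := if k == i then z else w k.
have exch F := exchange_sum phi w z F ij tn0.
have psi0 k : 0 <= psi k.
  rewrite /psi; case: ifP => _; first by rewrite divr_ge0// ltW.
  case: ifP => _; last by case/andP: (phi01 k).
  have -> : phi j + phi i * t / (1 + t) =
      (phi j * (1 + t) + phi i * t) / (1 + t).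
    by field.
  by rewrite divr_ge0// ltW.
have sumpsi : \sum_k psi k = 1.
  have := exch (fun=> 1); under eq_bigr do rewrite mulr1.
  under [in RHS]eq_bigr do rewrite mulr1.
  by rewrite /psi => ->; rewrite sum1; ring.
have dec : decomposition a b tau e psi y.
  split=> //.
  - by move=> k; rewrite psi0 fraction_le1.
  - by move=> k; rewrite /y; case: ifP.
  - by rewrite (exch fst) sumtau z1; field.
  - by rewrite (exch snd) sume z2; field.
have := equilibrium_ge eqm dec.
rewrite /mixture_entropy (exch (fun x => s x)) gerDl.
by rewrite pmulr_rle0 ?divr_gt0// subr_le0.
Qed.

(* A state y that is not a phase is made available to [equilibrium_exchange] as
   a subsystem of zero mass. *)
Lemma equilibrium_pad tau e n (phi : 'I_n -> R) w y :
  equilibrium Cv Rg a b s0 tau e phi w -> dom y ->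
  equilibrium Cv Rg a b s0 tau e (fun k => oapp phi 0 (unlift ord0 k))
    (fun k => oapp w y (unlift ord0 k)).
Proof.
move=> [[phi01 domw sum1 sumtau sume] eq_sigma] domy.
have pad F : \sum_k oapp phi 0 (unlift ord0 k) * F (oapp w y (unlift ord0 k)) =
    \sum_k phi k * F (w k).
  rewrite big_ord_recl unlift_none mul0r add0r.
  by apply: eq_bigr => k _; rewrite liftK.
split; last by rewrite -eq_sigma /mixture_entropy (pad (fun x => s x)).
split.
- by move=> k; case: unlift => [l|]; rewrite /= ?lexx ?ler01.
- by move=> k; case: unlift.
- rewrite big_ord_recl unlift_none add0r -sum1.
  by apply: eq_bigr => k _; rewrite liftK.
- by rewrite (pad fst).
- by rewrite (pad snd).
Qed.

(** * Tangent planes supporting the entropy *)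

Definition vdw_ds_dtau (x : R * R) : R :=
  - Cv * a / x.1 ^+ 2 / (a / x.1 + x.2) + Rg / (x.1 - b).
Definition vdw_ds_de (x : R * R) : R := Cv / (a / x.1 + x.2).
Definition vdw_tangent (x y : R * R) : R :=
  s x + vdw_ds_dtau x * (y.1 - x.1) + vdw_ds_de x * (y.2 - x.2).

Lemma is_derive_entropy_line (x : R * R) (d1 d2 : R) : dom x ->
  is_derive (0 : R) 1
    (fun t : R => vdw_entropy Cv Rg a b s0 (x.1 + t * d1) (x.2 + t * d2))
    (vdw_ds_dtau x * d1 + vdw_ds_de x * d2).
Proof.
move=> [x1 x2 bx ax]; have x10 := le_lt_trans b_ge0 bx.
have u0 : 0 < x.1 + 0 * d1 by rewrite mul0r addr0.
have dtau : is_derive (0 : R) 1 (fun t => (x.1 + t * d1)^-1) (- x.1 ^- 2 * d1).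
  have := @is_deriveV R (fun t => x.1 + t * d1) 0 d1 1 (lt0r_neq0 u0)
    (is_derive_affine x.1 d1 0).
  by rewrite mul0r addr0.
have dE : is_derive (0 : R) 1 (fun t => a / (x.1 + t * d1) + (x.2 + t * d2))
    (- a / x.1 ^+ 2 * d1 + d2).
  have de := is_derive_affine x.2 d2 0.
  by apply: is_derive_eq; rewrite /GRing.scale /=; ring.
have E0 : 0 < a / (x.1 + 0 * d1) + (x.2 + 0 * d2) by rewrite !mul0r !addr0.
have dlE := @is_derive1_comp _ (@ln R)
  (fun t => a / (x.1 + t * d1) + (x.2 + t * d2)) _ _ _ (is_derive1_ln E0) dE.
have dl : is_derive (0 : R) 1 (fun t => ln (x.1 + t * d1 - b)) (d1 / (x.1 - b)).
  have xb : 0 < x.1 - b by rewrite subr_gt0.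
  have := is_derive_ln_affine d1 xb.
  by under eq_fun do rewrite addrAC.
rewrite /vdw_entropy; apply: is_derive_eq.
rewrite /GRing.scale /= /vdw_ds_dtau /vdw_ds_de !mul0r !addr0.
ring.
Qed.

(** First-order condition for the exchange with parameter t * k, t > 0 small. A negative k draws
    mass from j, hence needs phi j > 0; the energy condition keeps the moved state in the domain. *)
Lemma equilibrium_tangent_dir tau e n (phi : 'I_n -> R) w i j (k : R) :
  equilibrium Cv Rg a b s0 tau e phi w -> i != j -> 0 < phi i ->
  0 <= k \/ 0 < phi j ->
  0 < (w i).2 \/ (w i).2 = 0 /\ (w j).2 = 0 ->
  k * (s (w j) - vdw_tangent (w i) (w j)) <= 0.
Proof.
move=> eqm ij phii kj eij; have [[phi01 domw _ _ _] _] := eqm.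
set d1 := k * ((w i).1 - (w j).1); set d2 := k * ((w i).2 - (w j).2).
have dl := is_derive_entropy_line d1 d2 (domw i).
(* The exchange inequality reads f t <= f 0, and the derivative of f at 0 is the expression to be
   bounded. *)
pose f t := vdw_entropy Cv Rg a b s0 ((w i).1 + t * d1) ((w i).2 + t * d2) +
  t * (k * (s (w j) - s (w i))).
apply: (@is_derive_le0_right R f 0).
  rewrite /f; apply: is_derive_eq.
  by rewrite /GRing.scale /= /vdw_tangent /d1 /d2; ring.
have /vdw_domainP[bi ei ai] := domw i.
have tb : \forall t \near 0^'+, 0 < ((w i).1 - b) + t * d1.
  by apply: near_right_affine_gt0; rewrite subr_gt0.
have te : \forall t \near 0^'+, (0 < (w i).2 + t * d2) ||
    [&& (w i).2 == 0 & (w i).2 + t * d2 == 0].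
  case: eij => [e0|[ei0 ej0]]; near=> t.
    by apply/orP; left; near: t; exact: near_right_affine_gt0.
  by rewrite /d2 ei0 ej0 subrr !mulr0 addr0 eqxx orbT.
have tm : \forall t \near 0^'+, 0 <= phi j * (1 + t * k) + phi i * (t * k).
  have phij : 0 <= phi j by case/andP: (phi01 j).
  case: kj => [k0|phij0]; near=> t.
    have t0 : 0 < t by near: t; exact: nbhs_right_gt.
    have tk : 0 <= t * k by rewrite mulr_ge0// ltW.
    by rewrite addr_ge0// mulr_ge0// ?addr_ge0// ltW.
  have : 0 < phi j + t * (k * (phi j + phi i)).
    by near: t; exact: near_right_affine_gt0.
  by move=> /ltW; congr (_ <= _); ring.
near=> t.
have t1 : 0 < 1 + t * k by near: t; exact: near_right_affine_gt0.
have t2 : 0 < ((w i).1 - b) + t * d1 by near: t.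
have t3 : (0 < (w i).2 + t * d2) || [&& (w i).2 == 0 & (w i).2 + t * d2 == 0].
  by near: t.
have t4 : 0 <= phi j * (1 + t * k) + phi i * (t * k) by near: t.
have domz : dom ((w i).1 + t * d1, (w i).2 + t * d2).
  apply/vdw_domainP; split=> /=; first lra.
    by case/orP: t3 => [/ltW//|/andP[_ /eqP->]].
  case: ai => [a0|e0]; first by left.
  by right; case/orP: t3 => // /andP[/eqP ei0]; rewrite ei0 ltxx in e0.
have z1 : (w i).1 + t * d1 = (w i).1 + t * k * ((w i).1 - (w j).1).
  by rewrite /d1; ring.
have z2 : (w i).2 + t * d2 = (w i).2 + t * k * ((w i).2 - (w j).2).
  by rewrite /d2; ring.
have := equilibrium_exchange (z := (_, _)) eqm ij phii t1 t4 z1 z2 domz.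
rewrite /f add0r !mul0r !addr0 /=; lra.
Unshelve. all: by end_near. Qed.

Lemma equilibrium_le_tangent tau e n (phi : 'I_n -> R) w i (y : R * R) :
  equilibrium Cv Rg a b s0 tau e phi w -> 0 < phi i -> dom y ->
  0 < (w i).2 \/ (w i).2 = 0 /\ y.2 = 0 ->
  s y <= vdw_tangent (w i) y.
Proof.
move=> eqm phii domy eiy.
have := @equilibrium_tangent_dir _ _ _ _ _ (lift ord0 i) ord0 1
  (equilibrium_pad eqm domy).
rewrite eq_sym neq_lift liftK unlift_none /= mul1r subr_le0.
by apply=> //; left; exact: ler01.
Qed.

(** Since j has mass, both k = 1 and k = -1 are allowed. *)
Lemma equilibrium_eq_tangent tau e n (phi : 'I_n -> R) w i j :
  equilibrium Cv Rg a b s0 tau e phi w -> 0 < phi i -> 0 < phi j ->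
  0 < (w i).2 \/ (w i).2 = 0 /\ (w j).2 = 0 ->
  s (w j) = vdw_tangent (w i) (w j).
Proof.
move=> eqm phii phij eij.
have [->|ij] := eqVneq i j.
  by rewrite /vdw_tangent !subrr !mulr0 !addr0.
have dir k := equilibrium_tangent_dir (k := k) eqm ij phii (or_intror phij) eij.
by have := dir 1; have := dir (- 1); lra.
Qed.

(** A positive mean energy yields a phase of positive energy; its tangent plane is the support, and
    theta is its value of a / tau + e. *)
Lemma equilibrium_support tau e n (phi : 'I_n -> R) w :
  equilibrium Cv Rg a b s0 tau e phi w -> 0 < e ->
  exists theta beta K, [/\ 0 < theta,
    forall y, dom y -> s y <= K + beta * y.1 + Cv / theta * y.2 &
    forall j, 0 < phi j -> s (w j) = K + beta * (w j).1 + Cv / theta * (w j).2].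
Proof.
move=> eqm e0; have [[phi01 domw _ _ sume] _] := eqm.
have [i phii ei] : exists2 i, 0 < phi i & 0 < (w i).2.
  apply: contrapT => noi; move: e0; rewrite -sume ltNge => /negP; apply.
  apply: sumr_le0 => i _; have /andP[phi0 _] := phi01 i.
  have [_ ei _ _] := domw i.
  have [phii|] := ltP 0 (phi i); last first.
    by move=> phi_0; rewrite (_ : phi i = 0) ?mul0r//; apply/le_anti/andP.
  have [ei'|] := ltP 0 (w i).2; first by case: noi; exists i.
  by rewrite pmulr_rle0.
have [_ _ _ ai] := domw i.
exists (a / (w i).1 + (w i).2), (vdw_ds_dtau (w i)),
  (s (w i) - vdw_ds_dtau (w i) * (w i).1 - vdw_ds_de (w i) * (w i).2).
have tangentE y : vdw_tangent (w i) y =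
    s (w i) - vdw_ds_dtau (w i) * (w i).1 - vdw_ds_de (w i) * (w i).2 +
    vdw_ds_dtau (w i) * y.1 + Cv / (a / (w i).1 + (w i).2) * y.2.
  by rewrite /vdw_tangent -/(vdw_ds_de (w i)); ring.
split=> // [y domy|j phij]; rewrite -tangentE.
  by apply: (equilibrium_le_tangent eqm phii domy); left.
exact: (equilibrium_eq_tangent eqm phii phij (or_introl ei)).
Qed.

(** Nonnegative energies with zero mean vanish on all phases. Only the volume can then be varied
    both ways, so the support is a line along e = 0. *)
Lemma equilibrium_support0 tau n (phi : 'I_n -> R) w :
  equilibrium Cv Rg a b s0 tau 0 phi w ->
  (forall j, 0 < phi j -> (w j).2 = 0) /\
  forall i, 0 < phi i -> exists beta K,
    (forall t, dom (t, 0) -> vdw_entropy Cv Rg a b s0 t 0 <= K + beta * t) /\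
    forall j, 0 < phi j -> s (w j) = K + beta * (w j).1.
Proof.
move=> eqm; have [[phi01 domw _ _ sume] _] := eqm.
have w0 j : 0 < phi j -> (w j).2 = 0.
  move=> phij; have nneg k : true -> 0 <= phi k * (w k).2.
    have [_ ? _ _] := domw k; have /andP[? _] := phi01 k.
    by move=> _; exact: mulr_ge0.
  have := psumr_eq0P nneg sume (i := j) isT => /eqP.
  by rewrite mulf_eq0 gt_eqF//= => /eqP.
split=> // i phii.
exists (vdw_ds_dtau (w i)), (s (w i) - vdw_ds_dtau (w i) * (w i).1).
have tangentE y : y.2 = 0 -> vdw_tangent (w i) y =
    s (w i) - vdw_ds_dtau (w i) * (w i).1 + vdw_ds_dtau (w i) * y.1.
  by move=> y0; rewrite /vdw_tangent y0 (w0 i phii); ring.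
split=> [t domt|j phij].
  rewrite -(tangentE (t, 0))//.
  by apply: (equilibrium_le_tangent eqm phii domt); right; rewrite w0.
rewrite -(tangentE _ (w0 _ phij)).
by apply: (equilibrium_eq_tangent eqm phii phij); right; rewrite !w0.
Qed.

Lemma ln_lt_tangent (u v : R) :
  0 < u -> 0 < v -> u != v -> ln u < ln v + u / v - 1.
Proof.
move=> u0 v0 uv; have uv0 : 0 < u / v by rewrite divr_gt0.
have : ln (u / v) != 0.
  apply: contra uv; rewrite ln_eq0// => /eqP uv1.
  by rewrite -(divfK (lt0r_neq0 v0) u) uv1 mul1r.
by move=> /expR_gt1Dx; rewrite lnK// ln_div//; lra.
Qed.

(** * Energies of the phases and reduction to one variable *)

Section phases.
Context (theta beta K : R) (theta_gt0 : 0 < theta).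
Context (support : forall y, dom y ->
  s y <= K + beta * y.1 + Cv / theta * y.2).

(** At fixed volume, s minus the plane is strictly concave in e and stationary at theta - a / tau,
    admissible here; from any other contact energy, moving there would rise above the plane. *)
Lemma phase_warm x : dom x -> s x = K + beta * x.1 + Cv / theta * x.2 ->
  a <= theta * x.1 -> x.2 = theta - a / x.1.
Proof.
move=> domx sx ax; have [x1 x2 bx w0] := domx.
have x10 := le_lt_trans b_ge0 bx.
apply/eqP; rewrite eq_sym subr_eq addrC eq_sym; apply: contraT => w_theta.
have domy : dom (x.1, theta - a / x.1).
  by split=> //=; [rewrite subr_ge0 ler_pdivrMr|rewrite addrC subrK].
have /= := support domy; rewrite /vdw_entropy addrCA subrr addr0.
have := ln_lt_tangent w0 theta_gt0 w_theta.
rewrite -(ltr_pM2l Cv_gt0).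
have -> : Cv * (ln theta + (a / x.1 + x.2) / theta - 1) =
  Cv * ln theta + Cv / theta * (a / x.1) + Cv / theta * x.2 - Cv by ring.
have -> : Cv / theta * (theta - a / x.1) = Cv - Cv / theta * (a / x.1).
  by field; rewrite !lt0r_neq0.
move: sx; rewrite /vdw_entropy; lra.
Qed.

(** The stationary energy is now negative, so s minus the plane strictly decreases over e >= 0 and
    contact is possible only at e = 0. *)
Lemma phase_cold x : dom x -> s x = K + beta * x.1 + Cv / theta * x.2 ->
  theta * x.1 < a -> x.2 = 0.
Proof.
move=> domx sx ax; have [x1 x2 bx w0] := domx.
have x10 := le_lt_trans b_ge0 bx.
have a0 : 0 < a by apply: lt_trans ax; rewrite mulr_gt0.
have u0 : 0 < a / x.1 by rewrite divr_gt0.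
apply/eqP; rewrite eq_le x2 andbT leNgt; apply/negP => x20.
have domy : dom (x.1, 0) by split=> //=; rewrite addr0.
have := support domy; rewrite /= /vdw_entropy addr0 mulr0.
have : a / x.1 + x.2 != a / x.1 by rewrite -subr_eq0 addrAC subrr add0r gt_eqF.
move=> /(ln_lt_tangent w0 u0); rewrite -(ltr_pM2l Cv_gt0).
have -> : Cv * (ln (a / x.1) + (a / x.1 + x.2) / (a / x.1) - 1) =
    Cv * ln (a / x.1) + Cv * (x.2 / (a / x.1)).
  by field; rewrite !lt0r_neq0.
have : Cv * (x.2 / (a / x.1)) <= Cv / theta * x.2.
  rewrite -mulrA ler_pM2l// mulrC ler_pM2r// lef_pV2 ?posrE// ler_pdivlMr//.
  exact: ltW.
move: sx; rewrite /vdw_entropy; lra.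
Qed.

Lemma profile_warmE t : 0 < t -> profile Rg b (Cv * (a / theta)) 0 beta t =
  vdw_entropy Cv Rg a b s0 t (theta - a / t) - beta * t
    - Cv / theta * (theta - a / t) + Cv - Cv * ln theta - s0.
Proof.
move=> t0; rewrite /profile /vdw_entropy addrCA subrr addr0; field.
by rewrite !lt0r_neq0.
Qed.

Lemma profile_coldE t : 0 < a -> 0 < t -> profile Rg b 0 Cv beta t =
  vdw_entropy Cv Rg a b s0 t 0 - beta * t - Cv * ln a - s0.
Proof.
by move=> a0 t0; rewrite /profile /vdw_entropy addr0 ln_div// mul0r; ring.
Qed.

(** Volumes below c = a / theta are cold and come first, so comparing x.1 and y.1 with c separates
    no cold phase, exactly one, and at least two. *)
Lemma sorted_phases_absurd x y z : dom x -> dom y -> dom z ->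
  s x = K + beta * x.1 + Cv / theta * x.2 ->
  s y = K + beta * y.1 + Cv / theta * y.2 ->
  s z = K + beta * z.1 + Cv / theta * z.2 ->
  x.1 < y.1 -> y.1 < z.1 -> False.
Proof.
move=> domx domy domz sx sy sz xy yz.
set c := a / theta; set Kc := K - s0 - Cv * ln a.
have pos t : b < t -> 0 < t := le_lt_trans b_ge0.
have warm_le t : b < t -> c <= t ->
    profile Rg b (Cv * c) 0 beta t <= K - s0 + Cv - Cv * ln theta.
  move=> bt; rewrite ler_pdivrMr// mulrC => ct; have t0 := pos _ bt.
  have domt : dom (t, theta - a / t).
    split=> //=; first exact: ltW.
      by rewrite subr_ge0 ler_pdivrMr.
    by rewrite addrC subrK.
  by have /= := support domt; rewrite /c profile_warmE//; lra.
have warm_eq p : dom p -> s p = K + beta * p.1 + Cv / theta * p.2 -> c <= p.1 ->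
    profile Rg b (Cv * c) 0 beta p.1 = K - s0 + Cv - Cv * ln theta.
  move=> domp sp cp; have [_ _ bp _] := domp.
  have ap : a <= theta * p.1 by rewrite mulrC -ler_pdivrMr.
  by rewrite /c profile_warmE ?pos// -(phase_warm domp sp ap) sp; ring.
have cold_le : 0 < a -> forall t, b < t -> profile Rg b 0 Cv beta t <= Kc.
  move=> a0 t bt; have t0 := pos _ bt.
  have domt : dom (t, 0) by split=> //=; [exact: ltW|rewrite addr0 divr_gt0].
  by have /= := support domt; rewrite mulr0 /Kc profile_coldE//; lra.
have cold_eq p : dom p -> s p = K + beta * p.1 + Cv / theta * p.2 -> p.1 < c ->
    0 < a /\ profile Rg b 0 Cv beta p.1 = Kc.
  move=> domp sp; rewrite ltr_pdivlMr// mulrC => cp; have [_ _ bp _] := domp.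
  have a0 : 0 < a by apply: lt_trans cp; rewrite mulr_gt0// pos.
  have p2 := phase_cold domp sp cp; split=> //.
  by rewrite p2 in sp; rewrite (profile_coldE a0 (pos _ bp)) sp /Kc; ring.
have [_ _ bx _] := domx; have by1 := lt_trans bx xy.
have [cx|xc] := leP c x.1.
  have cy := le_trans cx (ltW xy); have cz := le_trans cy (ltW yz).
  have [_ _ _ Rg_0] := profile_three_max b_ge0 bx cx xy yz warm_le
    (warm_eq _ domx sx cx) (warm_eq _ domy sy cy) (warm_eq _ domz sz cz).
  by move: Rg_gt0; rewrite Rg_0 ltxx.
have [a0 Fx] := cold_eq _ domx sx xc.
have c0 : 0 < c by rewrite divr_gt0.
have KcE : K - s0 + Cv - Cv * ln theta = Kc + Cv * ln c + Cv.
  by rewrite /Kc /c ln_div//; ring.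
have [cy|yc] := leP c y.1.
  have cz := le_trans cy (ltW yz).
  rewrite KcE in warm_le warm_eq.
  exact: (profile_mixed_max Rg_gt0 Cv_gt0 b_ge0 bx xc cy yz (cold_le a0)
    warm_le Fx (warm_eq _ domy sy cy) (warm_eq _ domz sz cz)).
have [_ Fy] := cold_eq _ domy sy yc.
(* Two cold phases force beta = 0, while the bound on the warm range, which extends to infinity,
   forces beta > 0. *)
have [_ beta_0 RgCv] := profile_two_max b_ge0 bx xy (cold_le a0) Fx Fy.
have : 0 < beta.
  apply: (profile_bounded_slope Rg_gt0 b_ge0 _ warm_le).
  by rewrite mulr_ge0// ltW.
by rewrite beta_0 ltxx.
Qed.

(** The volume of a phase determines its energy, so distinct phases have distinct volumes and can be
    sorted. *)
Lemma three_phases_absurd x y z : dom x -> dom y -> dom z ->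
  s x = K + beta * x.1 + Cv / theta * x.2 ->
  s y = K + beta * y.1 + Cv / theta * y.2 ->
  s z = K + beta * z.1 + Cv / theta * z.2 ->
  uniq [:: x; y; z] -> False.
Proof.
move=> domx domy domz sx sy sz /=; rewrite !inE negb_or andbT.
have inj p q : dom p -> dom q -> s p = K + beta * p.1 + Cv / theta * p.2 ->
    s q = K + beta * q.1 + Cv / theta * q.2 -> p.1 = q.1 -> p = q.
  move=> domp domq sp sq pq.
  suff pq2 : p.2 = q.2.
    by rewrite (surjective_pairing p) pq pq2 -surjective_pairing.
  have [ap|ap] := leP a (theta * p.1).
    by rewrite (phase_warm domp sp ap) (phase_warm domq sq) -?pq.
  by rewrite (phase_cold domp sp ap) (phase_cold domq sq) -?pq.
move=> /andP[/andP[/eqP xy /eqP xz] /eqP yz].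
have sorted := sorted_phases_absurd.
case: (ltgtP x.1 y.1) => [xy1|yx1|/(inj _ _ domx domy sx sy)//];
case: (ltgtP y.1 z.1) => [yz1|zy1|/(inj _ _ domy domz sy sz)//];
case: (ltgtP x.1 z.1) => [xz1|zx1|/(inj _ _ domx domz sx sz)//].
- exact: (sorted x y z).
- exact: (sorted x y z).
- exact: (sorted x z y).
- exact: (sorted z x y).
- exact: (sorted y x z).
- exact: (sorted y z x).
- exact: (sorted z y x).
- exact: (sorted z y x).
Qed.

End phases.

(** * From the phase count to a contradiction *)

Lemma nb_phasesP n (phi : 'I_n -> R) (w : 'I_n -> R * R) :
  (3 <= nb_phases phi w)%N -> exists i j k,
    [/\ 0 < phi i, 0 < phi j, 0 < phi k & uniq [:: w i; w j; w k]].
Proof.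
rewrite /nb_phases; set l := [seq w i | i <- _ & _].
have memu x : x \in undup l -> exists2 i, 0 < phi i & x = w i.
  rewrite mem_undup => /mapP[i]; rewrite mem_filter => /andP[? _] ->.
  by exists i.
have := undup_uniq l; case: undup memu => [|x [|y [|z r]]]// memu uniq_u _.
have [i phii xi] := memu x ltac:(by rewrite !inE eqxx).
have [j phij yj] := memu y ltac:(by rewrite !inE eqxx ?orbT).
have [k phik zk] := memu z ltac:(by rewrite !inE eqxx ?orbT).
exists i, j, k; split=> //; rewrite -xi -yj -zk.
by have := take_uniq 3 uniq_u; rewrite /= take0.
Qed.

End mixtures.

(* The states excluded by [nondeg] are genuine exceptions: if b = 0 and Rg = Cv
   then s(tau, 0) = Cv * ln a + s0 does not depend on tau, so every splitting of
   (tau, 0) is a maximizer, with any number of phases. *)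
Theorem theorem2 (R : realType) (Cv Rg a b s0 : R)
    (Rg_gt0 : 0 < Rg) (Cv_gt0 : 0 < Cv) (a_ge0 : 0 <= a) (b_ge0 : 0 <= b)
    (d2s_lt0 : forall tau e : R, vdw_domain a b (tau, e) ->
       vdw_d2s_de2 Cv Rg a b s0 tau e < 0)
    (tau e : R) (dom : vdw_domain a b (tau, e))
    (nondeg : ~ [/\ b = 0, Rg = Cv & e = 0])
    (n : nat) (phi : 'I_n -> R) (x : 'I_n -> R * R)
    (max : equilibrium Cv Rg a b s0 tau e phi x) :
  (nb_phases phi x < 3)%N.
Proof.
rewrite ltnNge; apply/negP => /nb_phasesP[i [j [k [phii phij phik xijk]]]].
have [[_ domx _ _ _] _] := max.
have [e0|] := ltP 0 e.
  have [theta [beta [K [theta0 support phases]]]] :=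
    equilibrium_support a_ge0 b_ge0 max e0.
  exact: (three_phases_absurd Rg_gt0 Cv_gt0 b_ge0 theta0 support
    (domx i) (domx j) (domx k)
    (phases _ phii) (phases _ phij) (phases _ phik) xijk).
move=> e_le0; have e0 : e = 0.
  by case: dom => /= _ e_ge0 _ _; apply/le_anti/andP.
subst e.
(* A state of zero energy lies in the domain only if a > 0, so the cold profile applies to all
   phases. *)
have [_ _ [a0|]] := (vdw_domainP a_ge0 b_ge0 _).1 dom; last by rewrite ltxx.
have [x0 support] := equilibrium_support0 a_ge0 b_ge0 max.
have [beta [K [le_s eq_s]]] := support i phii.
have pos t : b < t -> 0 < t := le_lt_trans b_ge0.
have F_le t : b < t -> profile Rg b 0 Cv beta t <= K - Cv * ln a - s0.
  move=> bt; rewrite (profile_coldE _ _ _ s0 _ a0 (pos _ bt)).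
  have domt : vdw_domain a b (t, 0).
    by split=> //=; [exact: ltW (pos _ bt)|rewrite addr0 divr_gt0// pos].
  by have := le_s t domt; lra.
have F_eq l : 0 < phi l -> profile Rg b 0 Cv beta (x l).1 = K - Cv * ln a - s0.
  move=> phil; have [_ _ bl _] := domx l.
  rewrite (profile_coldE _ _ _ s0 _ a0 (pos _ bl)).
  by have := eq_s l phil; rewrite x0// => ->; ring.
have two l m : 0 < phi l -> 0 < phi m -> (x l).1 < (x m).1 -> False.
  move=> phil phim lm; have [_ _ bl _] := domx l.
  have [b0 _ RgCv] := profile_two_max b_ge0 bl lm F_le
    (F_eq l phil) (F_eq m phim).
  (* A constant cold profile is exactly the excluded case. *)
  apply: nondeg; split=> //; apply/eqP; move/eqP: b0.
  by rewrite mulf_eq0 gt_eqF.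
have /eqP xij : x i != x j by move: xijk; rewrite /= !inE negb_or; case: eqP.
case: (ltgtP (x i).1 (x j).1) => [ij|ji|ij].
- exact: (two i j).
- exact: (two j i).
- apply: xij; rewrite (surjective_pairing (x i)) (surjective_pairing (x j)).
  by rewrite ij !x0.
Qed.
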